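(* Let $\ell\in\mathbb{N}$ and let $f\in\mathscr{F}_\ell$ be a tempered function. Let $W=\Delta^{\ell-1}f$ (so that, eventually, $W$ increases to $\infty$, $\Delta W$ decreases to $0$, and $\lim_{N\to\infty}N\cdot\Delta W(N)=\infty$). Suppose that $(x_n)_{n\in\mathbb{N}}$ is a bounded sequence in a Banach space $Y$ and let $L\in Y$. If $$\lim_{W(N)-W(M)\to\infty}\frac{1}{W(N)-W(M)}\sum_{n=M}^N\Delta W(n)\,x_n=L,$$ then $$\lim_{N\to\infty}\frac1N\sum_{n=1}^N x_n=L.$$
   Context: $\mathbb{N}=\{1,2,\dots\}$. For a function $f$ on $\mathbb{N}$, $\Delta f(n)=f(n)-f(n-1)$ for $n\ge2$ and $\Delta f(1)=f(1)$; $\Delta^0f=f$ and $\Delta^{j}f=\Delta(\Delta^{j-1}f)$ for $j\geq 1$. $\mathscr{F}_1$ is the set of functions $f:\mathbb{N}\to\mathbb{R}$ such that $\lim_{n\to\infty}f(n)=\infty$, $\lim_{n\to\infty}\Delta f(n)=0$ and $\Delta f$ is eventually decreasing; for $\ell\ge1$, $\mathscr{F}_{\ell+1}=\{f:\mathbb{N}\to\mathbb{R}:\Delta f\in\mathscr{F}_\ell\}$. A function $f:[a,\infty)\to\mathbb{R}$ is called tempered if there exists $\ell\in\mathbb{N}$ such that $f^{(\ell)}$ (the $\ell$-th derivative) decreases to $0$ and $\lim_{x\to\infty}xf^{(\ell)}(x)=\infty$. A function on $\mathbb{N}$ is called tempered if it is the restriction to $\mathbb{N}$ (for integers $n\ge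 a$) of such a function. The limit $\lim_{W(N)-W(M)\to\infty}$ is taken over all sequences of intervals $[M_j,N_j]$, $j\in\mathbb{N}$, with $M_j\le N_j$ in $\mathbb{N}$ and $W(N_j)-W(M_j)\to\infty$ as $j\to\infty$. Limits in $Y$ are in norm. *)

(* Defs.v *)
From HB Require Import structures.
From mathcomp Require Import all_boot all_order all_algebra.
From mathcomp Require Import all_classical all_reals all_analysis.

Set Implicit Arguments.
Unset Strict Implicit.
Unset Printing Implicit Defensive.

Import Order.TTheory GRing.Theory Num.Theory.
Import numFieldNormedType.Exports.

Local Open Scope classical_set_scope.
Local Open Scope ring_scope.

(* Functions and sequences on {1, 2, ...} are encoded as functions on [nat]
   whose value at 0 is junk. *)
Definition Delta (R : realType) (f : nat -> R) : nat -> R :=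
  fun n => if (n <= 1)%N then f n else f n - f n.-1.

(* [classF l] is the class F_l for l >= 1; [classF 0] is a dummy. *)
Fixpoint classF (R : realType) (l : nat) : set (nat -> R) :=
  match l with
  | 0 => set0
  | 1 => [set f | [/\ f n @[n --> \oo] --> +oo,
                      Delta f n @[n --> \oo] --> (0 : R) &
                      \forall n \near \oo, Delta f n.+1 <= Delta f n]]
  | l'.+1 => [set f | classF l' (Delta f)]
  end.

(* A function on [a, +oo[ is encoded as a total function whose values left of a
   are irrelevant, up to the following: derivatives at the endpoint a are
   two-sided.  This is harmless in [tempered_seq], where a may be enlarged. *)
Definition tempered (R : realType) (a : R) (g : R -> R) : Prop :=
  exists2 l : nat, (0 < l)%N &
    [/\ forall k x, (k < l)%N -> a <= x -> derivable (g^`(k))%classic x 1,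
        {in `[a, +oo[ &, nonincreasing_fun (g^`(l))%classic},
        (g^`(l))%classic x @[x --> +oo] --> (0 : R) &
        x * (g^`(l))%classic x @[x --> +oo] --> +oo].

Definition tempered_seq (R : realType) (f : nat -> R) : Prop :=
  exists (a : R) (g : R -> R), tempered a g /\
    forall n, (0 < n)%N -> a <= n%:R -> f n = g n%:R.

(* lim A(M, N) = L as W(N) - W(M) --> oo. *)
Definition interval_cvg (R : realType) (Y : normedModType R)
    (W : nat -> R) (A : nat -> nat -> Y) (L : Y) : Prop :=
  forall M N : nat -> nat,
    (forall j, (0 < M j)%N /\ (M j <= N j)%N) ->
    W (N j) - W (M j) @[j --> \oo] --> +oo ->
    A (M j) (N j) @[j --> \oo] --> L.

(* Main.v *)
(* The l-th backward difference of f at n is the value of the l-th derivative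
   of the tempered extension at a point of [n - l, n], so it tends to 0 and,
   multiplied by n, tends to infinity. Comparing the limits of the successive
   differences, the order of the derivative must be the index of the class F_l;
   hence w = Delta W is eventually positive and nonincreasing, and n w(n) tends
   to infinity. The hypothesis, uniform over long intervals, together with the
   boundedness of x on short ones, bounds the tails
   T_n = \sum_(n <= k <= N) w k (x k - L) by eps \sum_(n <= k <= N) w k + C with
   C independent of N. Summation by parts against the nondecreasing 1 / w turns
   this into |\sum_(n0 <= k <= N) (x k - L)| <= eps (N - n0 + 1) + C / w N, and
   C / w N = o(N). *)
Require Import Defs.
From HB Require Import structures.
From mathcomp Require Import all_boot all_order all_algebra.
From mathcomp Require Import all_classical all_reals all_analysis.
From mathcomp Require Import ring lra zify.

Set Implicit Arguments.
Unset Strict Implicit.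
Unset Printing Implicit Defensive.

Import Order.TTheory GRing.Theory Num.Theory.
Import numFieldNormedType.Exports.

Local Open Scope classical_set_scope.
Local Open Scope ring_scope.

Lemma sum_abel (R : pzRingType) (V : lmodType R) (c : nat -> R) (v : nat -> V)
    (m N : nat) : (m <= N)%N ->
  \sum_(m <= k < N.+1) c k *: v k = c m *: \sum_(m <= k < N.+1) v k +
    \sum_(m <= n < N) (c n.+1 - c n) *: \sum_(n.+1 <= k < N.+1) v k.
Proof.
elim: N => [|N IHN].
  rewrite leqn0 => /eqP->.
  by rewrite !big_nat1 big_geq // addr0.
rewrite leq_eqVlt => /orP[/eqP->|].
  by rewrite !big_nat1 big_geq // addr0.
rewrite ltnS => leN.
rewrite (big_nat_recr N.+1) ?leqW //= IHN // (big_nat_recr N.+1) ?leqW //=.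
have -> : \sum_(m <= n < N.+1) (c n.+1 - c n) *: \sum_(n.+1 <= k < N.+2) v k =
  \sum_(m <= n < N) (c n.+1 - c n) *: \sum_(n.+1 <= k < N.+1) v k +
  \sum_(m <= n < N.+1) (c n.+1 - c n) *: v N.+1.
  rewrite big_nat_recr //= [X in _ = _ + X]big_nat_recr //= addrA.
  congr (_ + _); last first.
    by rewrite big_nat1.
  rewrite -big_split /=; apply: eq_big_nat => i /andP[_ iN].
  by rewrite big_nat_recr ?scalerDr //= ltnS ltnW.
rewrite -scaler_suml telescope_sumr ?leqW // scalerDr scalerBl.
by rewrite addrACA subrKC -!addrA; congr (_ + _); rewrite addrC.
Qed.

(** Summation by parts with [c = 1 / w], which is positive and nondecreasing: each tail can be
    replaced by its bound. The constant [C] then gets the telescoping coefficient [1 / w N]. *)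
Lemma norm_sum_abel (R : realType) (Y : normedModType R) (w : nat -> R)
    (y : nat -> Y) (eps C : R) (m N : nat) : (m <= N)%N ->
  (forall k, (m <= k <= N)%N -> 0 < w k) ->
  (forall k, (m <= k < N)%N -> w k.+1 <= w k) ->
  (forall n, (m <= n <= N)%N -> `|\sum_(n <= k < N.+1) w k *: y k| <=
     eps * (\sum_(n <= k < N.+1) w k) + C) ->
  `|\sum_(m <= k < N.+1) y k| <= eps * (N.+1 - m)%:R + C / w N.
Proof.
move=> mN w0 wd T.
have -> : \sum_(m <= k < N.+1) y k =
    (w m)^-1 *: (\sum_(m <= k < N.+1) w k *: y k) +
    \sum_(m <= n < N) ((w n.+1)^-1 - (w n)^-1) *:
       \sum_(n.+1 <= k < N.+1) w k *: y k.
  transitivity (\sum_(m <= k < N.+1) (w k)^-1 *: (w k *: y k)).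
    apply: eq_big_nat => i iN.
    by rewrite scalerA mulVf ?scale1r // gt_eqF // w0.
  exact: sum_abel.
have -> : eps * (N.+1 - m)%:R + C / w N =
   (w m)^-1 * (eps * (\sum_(m <= k < N.+1) w k) + C) +
   \sum_(m <= n < N) ((w n.+1)^-1 - (w n)^-1) *
      (eps * (\sum_(n.+1 <= k < N.+1) w k) + C).
  (* The same identity with the constant 1 in place of [y] evaluates the part with [eps]. *)
  have -> : (N.+1 - m)%:R = (w m)^-1 * (\sum_(m <= k < N.+1) w k) +
      \sum_(m <= n < N) ((w n.+1)^-1 - (w n)^-1) * \sum_(n.+1 <= k < N.+1) w k.
    transitivity (\sum_(m <= k < N.+1) (w k)^-1 * w k).
      rewrite (eq_big_nat _ _ (F2 := fun=> 1)) ?sumr_const_nat // => i iN.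
      by rewrite mulVf // gt_eqF // w0.
    exact: (@sum_abel _ R^o).
  rewrite [X in _ = _ + X](eq_bigr (fun n =>
    eps * (((w n.+1)^-1 - (w n)^-1) * \sum_(n.+1 <= k < N.+1) w k) +
    ((w n.+1)^-1 - (w n)^-1) * C)); last by move=> n _; ring.
  rewrite big_split /= -mulr_suml -mulr_sumr telescope_sumr //; ring.
apply: le_trans (ler_normD _ _) _; apply: lerD.
  have wm : 0 < w m by apply: w0; rewrite leqnn.
  rewrite normrZ gtr0_norm ?invr_gt0 // ler_wpM2l ?invr_ge0 ?(ltW wm) //.
  by apply: T; rewrite leqnn.
apply: le_trans (ler_norm_sum _ _ _) _; apply: ler_sum_nat => i /andP[mi iN].
have d0 : 0 <= (w i.+1)^-1 - (w i)^-1.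
  have wi : 0 < w i by apply: w0; lia.
  have wi1 : 0 < w i.+1 by apply: w0; lia.
  by rewrite subr_ge0 lef_pV2 //; apply: wd; lia.
by rewrite normrZ ger0_norm // ler_wpM2l //; apply: T; lia.
Qed.

(** * Uniformity of limits over intervals *)

(** If no [K] worked, each [K = j.+1] would have a bad interval; these intervals form a sequence
    contradicting [interval_cvg]. *)
Lemma interval_cvg_unif (R : realType) (Y : normedModType R) (W : nat -> R)
    (A : nat -> nat -> Y) (L : Y) (eps : R) : 0 < eps -> interval_cvg W A L ->
  exists2 K : R, 0 < K & forall M N, (0 < M <= N)%N -> K <= W N - W M ->
    `|L - A M N| <= eps.
Proof.
move=> e0 hA; apply: contrapT => H.
have {}H j : exists MN : nat * nat, [/\ (0 < MN.1 <= MN.2)%N,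
    j.+1%:R <= W MN.2 - W MN.1 & ~ `|L - A MN.1 MN.2| <= eps].
  apply: contrapT => Hj; apply: H; exists j.+1%:R => // M N MN WMN.
  by apply: contrapT => ?; apply: Hj; exists (M, N).
have [MN MNP] := choice H.
have MN1 j : (0 < (MN j).1)%N /\ ((MN j).1 <= (MN j).2)%N.
  by have [/andP[]] := MNP j.
have WMN : W (MN j).2 - W (MN j).1 @[j --> \oo] --> +oo.
  apply: (@ger_cvgy _ _ _ _ (fun j => j%:R : R)); last exact: cvgr_idn.
  by near=> j; have [_ + _] := MNP j; apply: le_trans; rewrite ler_nat.
have /cvgrPdist_le/(_ _ e0)[j _ /(_ j (leqnn j)) /=] := hA _ _ MN1 WMN.
by have [] := MNP j.
Unshelve. all: by end_near.
Qed.

(** * Limits of iterated differences *)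

Lemma DeltaE (R : realType) (f : nat -> R) n : (1 < n)%N ->
  Delta f n = f n - f n.-1.
Proof. by move=> n1; rewrite /Delta leqNgt n1. Qed.

(** With [0 < m] the sum avoids the exceptional value [Delta f 1 = f 1]. *)
Lemma sum_Delta (R : realType) (f : nat -> R) m n : (0 < m <= n)%N ->
  \sum_(m.+1 <= k < n.+1) Delta f k = f n - f m.
Proof.
move=> /andP[m0 mn]; rewrite big_add1 /= -telescope_sumr //.
by apply: eq_big_nat => i /andP[mi _]; rewrite DeltaE //= ltnS (leq_trans m0).
Qed.

Lemma Delta_cvgy (R : realType) (f : nat -> R) :
  Delta f n @[n --> \oo] --> +oo -> f n @[n --> \oo] --> +oo.
Proof.
move=> /cvgryPge /(_ 1)[n0 _ Hn0].
(* Differences that are eventually at least 1 force at least linear growth. *)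
apply: (@ger_cvgy _ _ _ _ (fun n => n%:R + (f n0.+1 - n0.+1%:R))); last first.
  apply/cvgryPge => A; near=> n; rewrite -lerBlDr; near: n.
  exact: nbhs_infty_ger.
near=> n.
have n0n : (n0 < n)%N by near: n; exists n0.+1.
have : \sum_(n0.+2 <= k < n.+1) 1 <= \sum_(n0.+2 <= k < n.+1) Delta f k :> R.
  by apply: ler_sum_nat => i /andP[ni _]; apply: Hn0 => /=; lia.
rewrite sum_Delta // sumr_const_nat subSS natrB //; lra.
Unshelve. all: by end_near.
Qed.

Lemma iter_Delta_cvgy (R : realType) (f : nat -> R) i j : (i <= j)%N ->
  iter j (@Delta R) f n @[n --> \oo] --> +oo ->
  iter i (@Delta R) f n @[n --> \oo] --> +oo.
Proof.
elim: j => [|j IHj]; first by rewrite leqn0 => /eqP->.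
by rewrite leq_eqVlt => /orP[/eqP->//|ij] /Delta_cvgy; apply: IHj.
Qed.

Lemma Delta_cvg0 (R : realType) (f : nat -> R) :
  f n @[n --> \oo] --> (0 : R) -> Delta f n @[n --> \oo] --> (0 : R).
Proof.
move=> f0.
have f1 : f n.+1 @[n --> \oo] --> (0 : R) by rewrite -cvg_shiftS in f0.
have f2 : f n.+2 @[n --> \oo] --> (0 : R) by rewrite -cvg_shiftS in f1.
(* The shift by 2 skips the indices 0 and 1, where [Delta f] is not a difference. *)
have : Delta f n.+2 @[n --> \oo] --> (0 : R).
  rewrite (_ : (fun n => _) = fun n => f n.+2 - f n.+1).
    by have := cvgB f2 f1; rewrite subr0; apply.
  by apply/funext => n /=; rewrite DeltaE.
by rewrite (cvg_shiftS (fun n => Delta f n.+1)) (cvg_shiftS (Delta f)).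
Qed.

Lemma iter_Delta_cvg0 (R : realType) (f : nat -> R) i j : (i <= j)%N ->
  iter i (@Delta R) f n @[n --> \oo] --> (0 : R) ->
  iter j (@Delta R) f n @[n --> \oo] --> (0 : R).
Proof.
elim: j => [|j IHj]; first by rewrite leqn0 => /eqP->.
by rewrite leq_eqVlt => /orP[/eqP->//|ij] /(IHj ij) /Delta_cvg0.
Qed.

(* [Delta f k >= 1 / k] gives [f (2 n) - f n >= 1 / 2]. *)
Lemma Delta_tempered_Ncvg0 (R : realType) (f : nat -> R) :
  n%:R * Delta f n @[n --> \oo] --> +oo -> ~ f n @[n --> \oo] --> (0 : R).
Proof.
move=> /cvgryPge /(_ 1)[n0 _ Hn0] /cvgr0Pnorm_le /(_ 8^-1) [|n1 _ Hn1].
  by rewrite invr_gt0.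
pose n := (n0 + n1).+1.
have : \sum_(n.+1 <= k < (n + n).+1) (n + n)%:R^-1 <=
       \sum_(n.+1 <= k < (n + n).+1) Delta f k :> R.
  apply: ler_sum_nat => i /andP[ni iN].
  have i0 : 0 < i%:R :> R by rewrite ltr0n; lia.
  have : i%:R^-1 <= Delta f i.
    by rewrite -div1r ler_pdivrMr // mulrC; apply: Hn0 => /=; lia.
  by apply: le_trans; rewrite lef_pV2 ?posrE // ?ler_nat // ltr0n.
rewrite sum_Delta; last by rewrite leq_addr.
rewrite sumr_const_nat subSS addnK -[_ *+ n]mulr_natr natrD.
have -> : (n%:R + n%:R)^-1 * n%:R = 2^-1 :> R.
  have -> : n%:R + n%:R = 2 * n%:R :> R by rewrite mulr_natl mulr2n.
  by rewrite invfM -mulrA mulVf ?mulr1 // pnatr_eq0.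
have /= := Hn1 n; have /= := Hn1 (n + n)%N.
move=> /(_ ltac:(lia)) + /(_ ltac:(lia)).
rewrite !ler_norml => /andP[? ?] /andP[? ?]; lra.
Qed.

Lemma classF_iter (R : realType) (l : nat) (f : nat -> R) :
  classF l.+1 f -> classF 1 (iter l (@Delta R) f).
Proof.
by elim: l f => // l IHl f /IHl; rewrite iterSr.
Qed.

(** * Iterated differences and derivatives *)

(** Real-variable counterpart of iterated [Delta], without an exceptional value, to which the mean
    value theorem applies. *)
Definition nabla (R : realType) (j : nat) (h : R -> R) : R -> R :=
  iter j (fun u y => u y - u (y - 1)) h.

(** Differencing commutes with differentiation; [a + j%:R <= y] keeps the leftmost point used,
    [y - j], in the domain. *)
Lemma is_derive_nabla (R : realType) (a : R) (h : R -> R) (j : nat) (y : R) :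
  (forall y, a <= y -> derivable h y 1) -> a + j%:R <= y ->
  is_derive y 1 (nabla j h) (nabla j h^`()%classic y).
Proof.
move=> hd; elim: j y => [|j IHj] y.
  rewrite addr0 => ay; rewrite /= derive1E.
  by apply: DeriveDef => //; exact: hd.
rewrite -natr1 => ay /=; apply: is_deriveB; first by apply: IHj; lra.
rewrite -[nabla j _ (y - 1)]mulr1.
apply: (@is_derive1_comp _ (nabla j h) (fun z => z - 1)).
  by apply: IHj; lra.
by apply: is_derive_eq; rewrite subr0.
Qed.

(** Induction on [l]: the mean value theorem on [[y - 1, y]] trades one difference for one
    derivative, and the induction hypothesis applies to the derivative of [h]. *)
Lemma nabla_mvt (R : realType) (a : R) (l : nat) (h : R -> R) (y : R) :
  (forall k y, (k < l)%N -> a <= y -> derivable (h^`(k))%classic y 1) ->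
  a + l%:R <= y ->
  exists2 c, y - l%:R <= c <= y & nabla l h y = (h^`(l))%classic c.
Proof.
elim: l h y => [|l IHl] h y hd ay.
  by exists y; rewrite // subr0 lexx.
have hd0 z : a <= z -> derivable h z 1 by apply: (hd 0).
rewrite -natr1 in ay *.
have D z : a + l%:R <= z -> is_derive z 1 (nabla l h) (nabla l h^`()%classic z).
  exact: is_derive_nabla.
have y1 : y - 1 <= y by lra.
have cont : {within `[y - 1, y], continuous (nabla l h)}.
  apply: derivable_within_continuous => z; rewrite in_itv /= => /andP[? ?].
  by have [] : is_derive z 1 (nabla l h) (nabla l h^`()%classic z)
    by apply: D; lra.
have D' z : z \in `]y - 1, y[ ->
    is_derive z 1 (nabla l h) (nabla l h^`()%classic z).
  by rewrite in_itv /= => /andP[? ?]; apply: D; lra.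
have [c] := MVT_segment y1 D' cont.
rewrite in_itv /= => /andP[? ?] ->.
have hd1 k z : (k < l)%N -> a <= z -> derivable (h^`()^`(k))%classic z 1.
  by move=> kl az; rewrite -derive1Sn; apply: hd.
have ac : a + l%:R <= c by lra.
have [c' /andP[? ?] ->] := IHl h^`()%classic c hd1 ac.
by exists c'; [apply/andP; split; lra|rewrite -derive1Sn subKr mulr1].
Qed.

(** With [l < n], every [Delta] is taken at an index above 1. *)
Lemma iter_Delta_nabla (R : realType) (a : R) (f : nat -> R) (g : R -> R)
    (l n : nat) :
  (forall n, (0 < n)%N -> a <= n%:R -> f n = g n%:R) ->
  a + l%:R <= n%:R -> (l < n)%N ->
  iter l (@Delta R) f n = nabla l g n%:R.
Proof.
move=> fg; elim: l n => [|l IHl] n an ln.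
  by apply: fg => //; rewrite addr0 in an.
case: n => [//|n] in an ln *.
rewrite iterS DeltaE; last lia.
rewrite /= !IHl //; last lia.
  by rewrite -natr1 addrK.
all: move: an; rewrite -!natr1; lra.
Qed.

(** By monotonicity, the mean value point in [[n - l.+1, n]] squeezes [D n] between the derivative's
    values at the endpoints. The value at [n] alone gives the second limit. *)
Lemma tempered_Delta (R : realType) (f : nat -> R) : tempered_seq f ->
  exists l, let D := iter l.+1 (@Delta R) f in
    D n @[n --> \oo] --> (0 : R) /\ n%:R * D n @[n --> \oo] --> +oo.
Proof.
move=> [a [g [[[//|l] _ [gd gdec g0 gy] fg]]]]; exists l => D.
have DE : \forall n \near \oo, (g^`(l.+1))%classic n%:R <= D n <=
    (g^`(l.+1))%classic (n%:R - l.+1%:R).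
  near=> n.
  have an : a + l.+1%:R <= n%:R by near: n; exact: nbhs_infty_ger.
  rewrite /D (iter_Delta_nabla fg) //; last by near: n; exact: nbhs_infty_gt.
  have l0 : 0 <= l.+1%:R :> R by [].
  have [c /andP[? ?] ->] := nabla_mvt gd an.
  apply/andP; split; apply: gdec; rewrite ?in_itv /= ?andbT //; lra.
have nl : (n%:R - l.+1%:R : R) @[n --> \oo] --> +oo.
  apply/cvgryPge => A; near=> n; rewrite lerBrDr; near: n.
  exact: nbhs_infty_ger.
split.
  apply: (squeeze_cvgr DE).
    exact: (cvg_comp _ _ (@cvgr_idn R) g0).
  exact: (cvg_comp _ _ nl g0).
apply: ger_cvgy; last exact: (cvg_comp _ _ (@cvgr_idn R) gy).
near=> n => /=; rewrite ler_wpM2l //.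
by have /andP[] : (g^`(l.+1))%classic n%:R <= D n <=
    (g^`(l.+1))%classic (n%:R - l.+1%:R) by near: n.
Unshelve. all: by end_near.
Qed.

Lemma tempered_classF (R : realType) (l : nat) (f : nat -> R) :
  classF l.+1 f -> tempered_seq f ->
  n%:R * iter l.+1 (@Delta R) f n @[n --> \oo] --> +oo.
Proof.
move=> /classF_iter[fy f0 _] /tempered_Delta[k [k0 ky]].
have [lk|kl|<-//] := ltngtP k l.
  (* Order too small: the difference of order [k.+1 <= l] would tend both to infinity and to 0. *)
  have := iter_Delta_cvgy lk fy; move/cvgryPge/(_ 1) => H.
  move/cvgr0Pnorm_le: k0 => /(_ 2^-1 ltac:(by [])) H'.
  near \oo => n.
  have : 1 <= iter k.+1 (@Delta R) f n by near: n.
  have : `|iter k.+1 (@Delta R) f n| <= 2^-1 by near: n.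
  rewrite ler_norml => /andP[_]; lra.
(* Order too large: the difference of order [k >= l.+1] would tend to 0, although [n] times its own
   difference tends to infinity. *)
by case: (Delta_tempered_Ncvg0 ky); exact: (iter_Delta_cvg0 kl).
Unshelve. all: by end_near.
Qed.

(** * Bounds on weighted tails and the conclusion *)

Lemma norm_weighted_sum_le (R : realType) (Y : normedModType R) (W : nat -> R)
    (x : nat -> Y) (L : Y) (n0 : nat) (X K eps : R) : (0 < n0)%N ->
  (forall n, (n0 <= n)%N -> 0 < Delta W n) ->
  (forall n, (n0 <= n)%N -> Delta W n.+1 <= Delta W n) ->
  (forall n, (0 < n)%N -> `|x n| <= X) -> 0 <= X -> 0 < K -> 0 < eps ->
  (forall M N, (0 < M <= N)%N -> K <= W N - W M ->
    `|L - (W N - W M)^-1 *: \sum_(M <= n < N.+1) Delta W n *: x n| <= eps) ->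
  forall n N, (n0 <= n <= N)%N ->
  `|\sum_(n <= k < N.+1) Delta W k *: (x k - L)| <=
     eps * (\sum_(n <= k < N.+1) Delta W k) +
     (Delta W n0 * `|L| + (K + Delta W n0) * (X + `|L|)).
Proof.
move=> n00 w0 wd xX X0 K0 e0 hA n N /andP[n0n nN].
have L0 := normr_ge0 L.
have wB : Delta W n <= Delta W n0.
  elim: n n0n {nN} => [|n IHn]; first by rewrite leqn0 => /eqP->.
  rewrite leq_eqVlt => /orP[/eqP->//|]; rewrite ltnS => n0n.
  exact: le_trans (wd _ n0n) (IHn n0n).
have wn := w0 _ n0n.
have D0 : 0 <= W N - W n.
  rewrite -sum_Delta; last lia.
  by rewrite big_nat; apply: sumr_ge0 => i ?; apply/ltW/w0; lia.
have sE : \sum_(n <= k < N.+1) Delta W k = Delta W n + (W N - W n).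
  by rewrite big_ltn ?sum_Delta //; lia.
rewrite sE.
have [KD|DK] := leP K (W N - W n).
  have D1 : 0 < W N - W n by lra.
  have -> : \sum_(n <= k < N.+1) Delta W k *: (x k - L) =
    - ((W N - W n) *: (L - (W N - W n)^-1 *:
         \sum_(n <= k < N.+1) Delta W k *: x k))
      - Delta W n *: L.
    rewrite scalerBr scalerA mulfV ?gt_eqF // scale1r opprB -addrA -opprD.
    rewrite -scalerDl.
    under eq_bigr do rewrite scalerBr.
    by rewrite sumrB -scaler_suml sE [_ + Delta W n]addrC.
  apply: le_trans (ler_normB _ _) _.
  rewrite normrN !normrZ !gtr0_norm //.
  have := hA n N ltac:(lia) KD; move: (`|L - _|) => z ze.
  have := ler_wpM2l D0 ze.
  have := ler_wpM2r L0 wB.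
  have := mulr_ge0 (ltW e0) (ltW wn).
  have : 0 <= (K + Delta W n0) * (X + `|L|) by apply: mulr_ge0; lra.
  lra.
have : `|\sum_(n <= k < N.+1) Delta W k *: (x k - L)| <=
    (Delta W n + (W N - W n)) * (X + `|L|).
  rewrite -sE mulr_suml; apply: le_trans (ler_norm_sum _ _ _) _.
  apply: ler_sum_nat => i iN; have wi : 0 < Delta W i by apply: w0; lia.
  rewrite normrZ gtr0_norm // ler_pM2l //; apply: le_trans (ler_normB _ _) _.
  by rewrite lerD2r; apply: xX; lia.
move=> /le_trans; apply.
have : (Delta W n + (W N - W n)) * (X + `|L|) <= (K + Delta W n0) * (X + `|L|).
  by rewrite ler_wpM2r; lra.
have : 0 <= eps * (Delta W n + (W N - W n)) by apply: mulr_ge0; lra.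
have : 0 <= Delta W n0 * `|L| by apply: mulr_ge0; lra.
lra.
Qed.

Theorem theorem1 (R : realType) (Y : completeNormedModType R)
    (l : nat) (hl : (0 < l)%N)
    (f : nat -> R) (hf : classF l f) (ht : tempered_seq f)
    (W : nat -> R) (hW : W = iter l.-1 (@Delta R) f)
    (x : nat -> Y) (hx : [bounded x n | n in [set n | (0 < n)%N]])
    (L : Y)
    (hL : interval_cvg W
            (fun M N => (W N - W M)^-1 *:
               \sum_(M <= n < N.+1) Delta W n *: x n) L) :
  N%:R^-1 *: (\sum_(1 <= n < N.+1) x n) @[N --> \oo] --> L.
Proof.
case: l hl hf hW => // l _ hf /= hW.
have nw : n%:R * Delta W n @[n --> \oo] --> +oo.
  by rewrite hW; exact: tempered_classF hf ht.
have [_ _ wd] := classF_iter hf; rewrite -hW in wd.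
(* Monotonicity comes from the class, positivity from [n * Delta W n] tending to infinity. *)
have [n0 n00 [w0 {}wd]] : exists2 n0, (0 < n0)%N &
    (forall n, (n0 <= n)%N -> 0 < Delta W n) /\
    (forall n, (n0 <= n)%N -> Delta W n.+1 <= Delta W n).
  case: wd => n1 _ Hn1; move/cvgryPgt/(_ 0): nw => [n2 _ Hn2].
  exists (n1 + n2).+1 => //; split => n ?; last by apply: Hn1 => /=; lia.
  have := Hn2 n ltac:(rewrite /=; lia); rewrite /= pmulr_rgt0 // ltr0n; lia.
have [X X0 xX] : exists2 X, 0 <= X & forall n, (0 < n)%N -> `|x n| <= X.
  have [X [_ /(_ (`|X| + 1) _)]] := hx.
  by move=> H; exists (`|X| + 1) => //; apply: H; rewrite ltr_pwDr // ler_norm.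
apply/cvgrPdist_le => eps e0.
(* One third each for the head [P] below [n0], the average error over the tail, and
   [C / Delta W N]. *)
have e3 : 0 < eps / 3 by rewrite divr_gt0.
have [K K0 hK] := interval_cvg_unif e3 hL.
have hT := norm_weighted_sum_le n00 w0 wd xX X0 K0 e3 hK.
set C := Delta W n0 * _ + _ in hT.
pose P := `|\sum_(1 <= k < n0) (x k - L)|.
near=> N.
have n0N : (n0 <= N)%N by near: N; exists n0.
have N0 : 0 < N%:R :> R by rewrite ltr0n; lia.
have PN : P * 3 / eps <= N%:R by near: N; exact: nbhs_infty_ger.
have CN : C * 3 / eps <= N%:R * Delta W N.
  by near: N; move/cvgryPge: nw; apply.
have wN := w0 _ n0N.
have S : `|\sum_(1 <= k < N.+1) (x k - L)| <=
    P + (eps / 3 * N%:R + C / Delta W N).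
  rewrite (big_cat_nat _ (n := n0)) //=; last lia.
  apply: le_trans (ler_normD _ _) _; rewrite lerD2l.
  have := @norm_sum_abel R Y (Delta W) (fun k => x k - L) (eps / 3) C n0 N n0N.
  move=> /(_ ltac:(by move=> k /andP[? _]; exact: w0)).
  move=> /(_ ltac:(by move=> k /andP[? _]; exact: wd)).
  move=> /(_ ltac:(by move=> n ?; exact: hT)) /le_trans; apply.
  by rewrite lerD2r ler_wpM2l ?ler_nat ?(ltW e3) //; lia.
have -> : L - N%:R^-1 *: (\sum_(1 <= n < N.+1) x n) =
    - (N%:R^-1 *: \sum_(1 <= k < N.+1) (x k - L)).
  rewrite sumrB sumr_const_nat subn1 /= -[L *+ N]scaler_nat scalerBr scalerA.
  by rewrite mulVf ?gt_eqF // scale1r opprB.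
rewrite normrN normrZ gtr0_norm ?invr_gt0 // mulrC ler_pdivrMr //.
apply: le_trans S _.
have : P <= eps / 3 * N%:R.
  by move: PN; rewrite ler_pdivrMr //; lra.
have : C / Delta W N <= eps / 3 * N%:R.
  by rewrite ler_pdivrMr //; move: CN; rewrite ler_pdivrMr //; lra.
lra.
Unshelve. all: by end_near.
Qed.
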